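(* The cardinality assignment on $\mathbb P$-spans is functorial: the cardinality of a composed $\mathbb P$-span is the matrix product of the two individual cardinality matrices. Precisely, let $I\leftarrow M\to J$ and $J\leftarrow N\to K$ be $\mathbb P$-spans between finite groupoids with parity structure $I,J,K$. Then for fixed $i\in\pi_0(I^\circ)$ and $k\in\pi_0(K^\circ)$ one has the identity of rational numbers $$ {}_i[M\times_J N]_k=\sum_{j\in\pi_0(J^\circ)}{}_i[M]_j\cdot{}_j[N]_k . $$
   Context: Let $O(1)=\{+1,-1\}$ and let $\mathbb P=BO(1)$ be the one-object groupoid with automorphism group $O(1)$. All groupoids are finite (finitely many isomorphism classes, finite hom sets), and pullbacks, fibres and quotients are homotopy ones. A parity structure on a groupoid $S$ is a functor $S\to\mathbb P$; it assigns to each arrow $a$ a parity $\mathrm{par}(a)\in\{\pm1\}$ (even $=+1$, odd $=-1$), multiplicatively. $\mathsf e:1\to\mathbb P$ is the unique parity structure on the terminal groupoid. A point of a parity groupoid $I$ is orientable if it has no odd automorphism; $I^\circ\subset I$ is the full subgroupoid of orientable points. A $\mathbb P$-span from $f:S\to\mathbb P$ to $g:T\to\mathbb P$ is a span of groupoids $S\xleftarrow{p}M\xrightarrow{q}T$ with a natural isomorphism $\rho:f p\Rightarrow g q$, i.e. signs $\rho_x\in\{\pm1\}$ with $\mathrm{par}(p(a))\,\rho_{x'}=\rho_x\,\mathrm{par}(q(a))$ for each $a:x\to x'$ in $M$. Composition is by homotopy pullback, with the sign of an object $(m,a:q(m)\to p'(n),n)$ of $M\times_JN$ being $\rho_m\cdot\mathrm{par}(a)\cdot\rho'_n$.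 A scalar is a $\mathbb P$-span from $\mathsf e$ to $\mathsf e$; its groupoid splits by sign as $S=S_\oplus\sqcup S_\ominus$. The two-sided fibre ${}_iM_j$ of a $\mathbb P$-span $I\xleftarrow{p}M\xrightarrow{q}J$ is the scalar with objects $(m,\,a:i\to p(m),\,b:q(m)\to j)$ and sign $\mathrm{par}(a)\rho_m\mathrm{par}(b)$. The cardinality of a finite groupoid is $|S|=\sum_{s\in\pi_0S}1/|\mathrm{Aut}(s)|$, and the cardinality of a scalar is $|\widehat S|=|S_\oplus|-|S_\ominus|$. Write $j!=\mathrm{Aut}(j)$. For each parity groupoid fix a choice of one base point in each orientable component. The cardinality of a $\mathbb P$-span $I\leftarrow M\to J$ is the linear map $\mathbb Q_{\pi_0I^\circ}\to\mathbb Q_{\pi_0J^\circ}$ (between the vector spaces spanned by the orientable components) given by the $\pi_0(I^\circ)$-by-$\pi_0(J^\circ)$ matrix $[M]$ with entries ${}_i[M]_j:=|{}_iM_j/j!|=|{}_iM_j|/|j!|$, where $i,j$ denote the chosen base points and $j!$ acts on the scalar ${}_iM_j$ by postcomposition on $b$ (a sign-preserving action since $j$ has no odd automorphisms). *)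

(* Defs.v *)
From HB Require Import structures.
From mathcomp Require Import all_boot all_order all_algebra.
From mathcomp Require Import generic_quotient boolp.

Set Implicit Arguments.
Unset Strict Implicit.
Unset Printing Implicit Defensive.

Import GRing.Theory.

Declare Scope gpd_scope.
Delimit Scope gpd_scope with gpd.
Local Open Scope gpd_scope.
Local Open Scope quotient_scope.

#[local] Obligation Tactic := idtac.

(* Composition is written in diagrammatic order.  The type of objects is
   arbitrary: only the set of isomorphism classes has to be finite, which is
   expressed by a finite family meeting every class.                          *)
Record groupoid := Groupoid {
  ob :> Type;
  hom : ob -> ob -> finType;
  idm : forall x, hom x x;
  gcomp : forall x y z, hom x y -> hom y z -> hom x z;
  ginv : forall x y, hom x y -> hom y x;
  gcomp1m : forall x y (a : hom x y), gcomp (idm x) a = a;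
  gcompm1 : forall x y (a : hom x y), gcomp a (idm y) = a;
  gcompA : forall x y z t (a : hom x y) (b : hom y z) (c : hom z t),
    gcomp a (gcomp b c) = gcomp (gcomp a b) c;
  gcompmV : forall x y (a : hom x y), gcomp a (ginv a) = idm x;
  gcompVm : forall x y (a : hom x y), gcomp (ginv a) a = idm y;
  fin_classes : exists (F : finType) (r : F -> ob),
    forall x, exists k, inhabited (hom x (r k))
}.

Arguments idm {g} x.
Notation "a ;; b" := (gcomp a b)
  (at level 50, left associativity, format "a  ;;  b") : gpd_scope.

Record functor (S T : groupoid) := Functor {
  fob :> S -> T;
  fmap : forall x y, hom x y -> hom (fob x) (fob y);
  fmap1 : forall x, fmap (idm x) = idm (fob x);
  fmapM : forall x y z (a : hom x y) (b : hom y z),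
    fmap (a ;; b) = fmap a ;; fmap b
}.

Arguments fmap {S T} f {x y}.

Program Definition functor_comp (R S T : groupoid) (F : functor R S)
    (G : functor S T) : functor R T :=
  @Functor R T (fun x => G (F x)) (fun x y a => fmap G (fmap F a)) _ _.
Next Obligation. by move=> * /=; rewrite !fmap1. Qed.
Next Obligation. by move=> * /=; rewrite !fmapM. Qed.

(* All arrows being invertible, a natural transformation is a natural
   isomorphism.                                                               *)
Record natiso (S T : groupoid) (F G : functor S T) := NatIso {
  cpt :> forall x : S, hom (F x) (G x);
  cpt_nat : forall (x y : S) (a : hom x y),
    fmap F a ;; cpt y = cpt x ;; fmap G a
}.

(* The group O(1) = {+1, -1} is encoded as bool with exclusive or:
   false is +1 (even), true is -1 (odd).                                      *)
Program Definition BO1 : groupoid :=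
  @Groupoid unit (fun _ _ => bool : finType) (fun _ => false)
    (fun _ _ _ a b => a (+) b) (fun _ _ a => a) _ _ _ _ _ _.
Next Obligation. by move=> *. Qed.
Next Obligation. by move=> * /=; rewrite addbF. Qed.
Next Obligation. by move=> * /=; rewrite addbA. Qed.
Next Obligation. by move=> * /=; rewrite addbb. Qed.
Next Obligation. by move=> * /=; rewrite addbb. Qed.
Next Obligation. by exists unit, id => x; exists tt; split; exact: false. Qed.

Record pgroupoid := PGroupoid {
  pg_gpd :> groupoid;
  parity : functor pg_gpd BO1
}.

Definition par (I : pgroupoid) (x y : I) (a : hom x y) : bool :=
  fmap (parity I) a.

Program Definition point : groupoid :=
  @Groupoid unit (fun _ _ => unit : finType) (fun _ => tt)
    (fun _ _ _ _ _ => tt) (fun _ _ _ => tt) _ _ _ _ _ _.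
Next Obligation. by move=> _ _ []. Qed.
Next Obligation. by move=> _ _ []. Qed.
Next Obligation. by move=> *. Qed.
Next Obligation. by move=> *. Qed.
Next Obligation. by move=> *. Qed.
Next Obligation. by exists unit, id => x; exists tt; split; exact: tt. Qed.

Program Definition to_point (S : groupoid) : functor S point :=
  @Functor S point (fun _ => tt) (fun _ _ _ => tt) _ _.
Next Obligation. by move=> *. Qed.
Next Obligation. by move=> *. Qed.

Program Definition epar : functor point BO1 :=
  @Functor point BO1 id (fun _ _ _ => false) _ _.
Next Obligation. by move=> *. Qed.
Next Obligation. by move=> *. Qed.

Definition epoint : pgroupoid := PGroupoid epar.

Record pspan (I J : pgroupoid) := PSpan {
  apex : groupoid;
  src : functor apex I;
  tgt : functor apex J;
  sgn : natiso (functor_comp src (parity I)) (functor_comp tgt (parity J))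
}.

Definition pscalar := pspan epoint epoint.

Section FullSub.
Variables (S : groupoid) (P : pred S).

Program Definition full_sub : groupoid :=
  @Groupoid {x : S | P x} (fun x y => hom (sval x) (sval y))
    (fun x => idm (sval x)) (fun _ _ _ a b => a ;; b) (fun _ _ a => ginv a)
    _ _ _ _ _ _.
Next Obligation. by move=> * /=; rewrite gcomp1m. Qed.
Next Obligation. by move=> * /=; rewrite gcompm1. Qed.
Next Obligation. by move=> * /=; rewrite gcompA. Qed.
Next Obligation. by move=> * /=; rewrite gcompmV. Qed.
Next Obligation. by move=> * /=; rewrite gcompVm. Qed.
Next Obligation.
have [F [r rP]] := fin_classes S.
pose Q k := `[< exists x : {x : S | P x}, inhabited (hom (sval x) (r k)) >].
have QP (k : {k : F | Q k}) :
  exists x : {x : S | P x}, inhabited (hom (sval x) (r (sval k))).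
  exact: (asboolP _ (svalP k)).
exists {k : F | Q k}, (fun k => projT1 (cid (QP k))) => x.
have [k [a]] := rP (sval x).
have Qk : Q k by apply/asboolP; exists x.
exists (exist _ k Qk); case: (cid _) => y /= [b].
by split; exact: (a ;; ginv b).
Qed.

Program Definition incl : functor full_sub S :=
  @Functor full_sub S sval (fun _ _ a => a) _ _.
Next Obligation. by move=> *. Qed.
Next Obligation. by move=> *. Qed.

End FullSub.

Definition orientable (I : pgroupoid) : pred I :=
  fun x => [forall a : hom x x, ~~ par a].

Definition orient (I : pgroupoid) : groupoid := full_sub (@orientable I).

(* Isomorphism classes: x and y are isomorphic iff there is an arrow x -> y.
   {classic S} is the type of objects of S with a choice structure.           *)
Definition isomorphic (S : groupoid) : rel {classic S} :=
  fun x y => 0 < #|hom (x : S) (y : S)|.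

Lemma isomorphicP (S : groupoid) (x y : S) :
  reflect (inhabited (hom x y)) (isomorphic x y).
Proof.
apply: (iffP card_gt0P) => [[a _]|[a]]; first by split.
by exists a.
Qed.

Lemma isomorphic_refl (S : groupoid) : reflexive (@isomorphic S).
Proof. by move=> x; apply/isomorphicP; split; exact: idm. Qed.

Lemma isomorphic_sym (S : groupoid) : symmetric (@isomorphic S).
Proof.
by move=> x y; apply/isomorphicP/isomorphicP => -[a]; split; exact: ginv a.
Qed.

Lemma isomorphic_trans (S : groupoid) : transitive (@isomorphic S).
Proof.
move=> y x z /isomorphicP[a] /isomorphicP[b]; apply/isomorphicP; split.
exact: (a ;; b).
Qed.

Canonical isomorphic_equiv (S : groupoid) : equiv_rel {classic S} :=
  EquivRel (@isomorphic S) (@isomorphic_refl S) (@isomorphic_sym S)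
    (@isomorphic_trans S).

Definition pi0 (S : groupoid) : Type := {eq_quot isomorphic_equiv S}.

Definition cls (S : groupoid) (x : S) : pi0 S :=
  \pi_({eq_quot isomorphic_equiv S}) (x : {classic S}).

Definition rep (S : groupoid) (c : pi0 S) : S :=
  repr (c : {eq_quot isomorphic_equiv S}).

Lemma clsP (S : groupoid) (x y : S) :
  cls x = cls y <-> inhabited (hom x y).
Proof.
rewrite /cls; split => [/eqmodP /= /isomorphicP //|xy].
by apply/eqmodP/isomorphicP; exact: xy.
Qed.

Lemma repK (S : groupoid) : cancel (@rep S) (@cls S).
Proof. by move=> c; rewrite /cls /rep reprK. Qed.

HB.instance Definition _ (S : groupoid) :=
  Choice.copy (pi0 S) {eq_quot isomorphic_equiv S}.

Lemma pi0_finite (S : groupoid) : exists s : seq (pi0 S), forall c, c \in s.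
Proof.
have [F [r rP]] := fin_classes S.
exists [seq cls (r k) | k <- enum F] => c.
have [k kP] := rP (rep c); apply/mapP; exists k; first by rewrite mem_enum.
by rewrite -[c]repK; apply/clsP.
Qed.

Definition pi0_enum (S : groupoid) : seq (pi0 S) :=
  undup (projT1 (cid (pi0_finite S))).

Lemma mem_pi0_enum (S : groupoid) (c : pi0 S) : c \in pi0_enum S.
Proof. by rewrite mem_undup; case: (cid _). Qed.

Definition pi0_index (S : groupoid) (c : pi0 S) : nat := index c (pi0_enum S).

Lemma pi0_indexK (S : groupoid) : pcancel (@pi0_index S) (onth (pi0_enum S)).
Proof.
move=> c; rewrite /pi0_index onthE (nth_map c) ?nth_index ?index_mem //;
  exact: mem_pi0_enum.
Qed.

HB.instance Definition _ (S : groupoid) :=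
  @Choice_isCountable.Build (pi0 S) _ _ (@pi0_indexK S).

Lemma pi0_enumP (S : groupoid) : Finite.axiom (pi0_enum S).
Proof. by move=> c; rewrite count_uniq_mem ?undup_uniq // mem_pi0_enum. Qed.

HB.instance Definition _ (S : groupoid) :=
  isFinite.Build (pi0 S) (@pi0_enumP S).

Definition gcard (S : groupoid) : rat :=
  (\sum_(c : pi0 S) #|hom (rep c) (rep c)|%:R^-1)%R.

Definition is_neg (S : pscalar) : pred (apex S) := fun x => sgn S x.

Definition pos_part (S : pscalar) : groupoid :=
  full_sub (fun x => ~~ is_neg (S := S) x).

Definition neg_part (S : pscalar) : groupoid := full_sub (@is_neg S).

Definition scard (S : pscalar) : rat :=
  (gcard (pos_part S) - gcard (neg_part S))%R.

Section HomotopyPullback.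
Variables (S T J : groupoid) (F : functor S J) (G : functor T J).

Record hpb_ob := HpbOb {
  hpb1 : S;
  hpb2 : T;
  hpb_arr : hom (F hpb1) (G hpb2)
}.

Definition hpb_hom (x y : hpb_ob) : finType :=
  {u : hom (hpb1 x) (hpb1 y) * hom (hpb2 x) (hpb2 y) |
    fmap F u.1 ;; hpb_arr y == hpb_arr x ;; fmap G u.2}.

Program Definition hpb : groupoid :=
  @Groupoid hpb_ob hpb_hom
    (fun x => exist _ (idm (hpb1 x), idm (hpb2 x)) _)
    (fun x y z a b =>
       exist _ ((sval a).1 ;; (sval b).1, (sval a).2 ;; (sval b).2) _)
    (fun x y a => exist _ (ginv (sval a).1, ginv (sval a).2) _)
    _ _ _ _ _ _.
Next Obligation. by move=> x /=; rewrite !fmap1 gcomp1m gcompm1. Qed.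
Next Obligation.
move=> x y z [[a1 a2] /= /eqP ea] [[b1 b2] /= /eqP eb].
by rewrite !fmapM -gcompA eb gcompA ea gcompA.
Qed.
Next Obligation.
move=> x y [[a1 a2] /= /eqP ea].
rewrite -[X in X == _]gcompm1 -(fmap1 G) -(gcompmV a2) fmapM gcompA.
by rewrite -[X in X ;; _ == _]gcompA -ea gcompA -fmapM gcompVm fmap1 gcomp1m.
Qed.
Next Obligation.
by move=> x y [[a b] e]; apply: val_inj; rewrite /= !gcomp1m.
Qed.
Next Obligation.
by move=> x y [[a b] e]; apply: val_inj; rewrite /= !gcompm1.
Qed.
Next Obligation. by move=> *; apply: val_inj; rewrite /= !gcompA. Qed.
Next Obligation. by move=> x y a; apply: val_inj; rewrite /= !gcompmV. Qed.
Next Obligation. by move=> x y a; apply: val_inj; rewrite /= !gcompVm. Qed.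
Next Obligation.
have [A [r rP]] := fin_classes S; have [B [s sP]] := fin_classes T.
exists {u : A * B & hom (F (r u.1)) (G (s u.2))},
  (fun u => HpbOb (projT2 u)) => -[m n c].
have [k [a]] := rP m; have [l [b]] := sP n.
exists (existT _ (k, l) (fmap F (ginv a) ;; c ;; fmap G b)); split.
exists (a, b) => /=.
by rewrite !gcompA -fmapM gcompmV fmap1 gcomp1m.
Qed.

Program Definition hpb_pr1 : functor hpb S :=
  @Functor hpb S hpb1 (fun _ _ a => (sval a).1) _ _.
Next Obligation. by move=> *. Qed.
Next Obligation. by move=> *. Qed.

Program Definition hpb_pr2 : functor hpb T :=
  @Functor hpb T hpb2 (fun _ _ a => (sval a).2) _ _.
Next Obligation. by move=> *. Qed.
Next Obligation. by move=> *. Qed.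

End HomotopyPullback.

Section Composition.
Variables (I J K : pgroupoid) (M : pspan I J) (N : pspan J K).

Let P := hpb (tgt M) (src N).
Let p : functor P I := functor_comp (hpb_pr1 (tgt M) (src N)) (src M).
Let q : functor P K := functor_comp (hpb_pr2 (tgt M) (src N)) (tgt N).

Program Definition comp_sgn :
    natiso (functor_comp p (parity I)) (functor_comp q (parity K)) :=
  @NatIso P BO1 (functor_comp p (parity I)) (functor_comp q (parity K))
    (fun x => sgn M (hpb1 x) (+) par (hpb_arr x) (+) sgn N (hpb2 x)) _.
Next Obligation.
move=> x y [[a1 a2] /= /eqP e].
have := cpt_nat (sgn M) a1; have := cpt_nat (sgn N) a2.
have := congr1 (@par _ _ _) e; rewrite /par !fmapM /=.
move: (fmap _ _) (fmap _ _) (fmap _ _) (fmap _ _) (fmap _ _) (fmap _ _) => /=.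
move: (sgn M _) (sgn M _) (sgn N _) (sgn N _) => /=.
by do 10!case.
Qed.

Definition pspan_comp : pspan I K := PSpan comp_sgn.

End Composition.

Section TwoSidedFibre.
Variables (I J : pgroupoid) (M : pspan I J) (i : I).

Record fib_ob (j : J) := FibOb {
  fib_pt : apex M;
  fib_l : hom i (src M fib_pt);
  fib_r : hom (tgt M fib_pt) j
}.

Definition fib_sgn (j : J) (x : fib_ob j) : bool :=
  par (fib_l x) (+) sgn M (fib_pt x) (+) par (fib_r x).

Definition fib_hom (j : J) (x y : fib_ob j) : finType :=
  {u : hom (fib_pt x) (fib_pt y) |
    (fib_l x ;; fmap (src M) u == fib_l y) &&
    (fib_r x == fmap (tgt M) u ;; fib_r y)}.

Program Definition fib_gpd (j : J) : groupoid :=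
  @Groupoid (fib_ob j) (@fib_hom j)
    (fun x => exist _ (idm (fib_pt x)) _)
    (fun x y z a b => exist _ (sval a ;; sval b) _)
    (fun x y a => exist _ (ginv (sval a)) _)
    _ _ _ _ _ _.
Next Obligation. by move=> j x /=; rewrite !fmap1 gcomp1m gcompm1 !eqxx. Qed.
Next Obligation.
move=> j x y z [a /= /andP[/eqP a1 /eqP a2]] [b /= /andP[/eqP b1 /eqP b2]].
by rewrite !fmapM gcompA a1 b1 a2 b2 gcompA !eqxx.
Qed.
Next Obligation.
move=> j x y [a /= /andP[/eqP a1 /eqP a2]].
rewrite -a1 a2 gcompA -fmapM gcompVm fmap1 gcomp1m eqxx andbT.
by rewrite -gcompA -fmapM gcompmV fmap1 gcompm1.
Qed.
Next Obligation. by move=> *; apply: val_inj; rewrite /= gcomp1m. Qed.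
Next Obligation. by move=> *; apply: val_inj; rewrite /= gcompm1. Qed.
Next Obligation. by move=> *; apply: val_inj; rewrite /= gcompA. Qed.
Next Obligation. by move=> *; apply: val_inj; rewrite /= gcompmV. Qed.
Next Obligation. by move=> *; apply: val_inj; rewrite /= gcompVm. Qed.
Next Obligation.
move=> j; have [A [r rP]] := fin_classes (apex M).
exists {k : A & hom i (src M (r k)) * hom (tgt M (r k)) j}%type,
  (fun u => FibOb (projT2 u).1 (projT2 u).2) => -[m a b].
have [k [c]] := rP m.
exists (existT _ k (a ;; fmap (src M) c, fmap (tgt M) (ginv c) ;; b)); split.
exists c => /=.
by rewrite gcompA -fmapM gcompmV fmap1 gcomp1m !eqxx.
Qed.

Lemma fib_sgn_nat (j : J) (x y : fib_ob j) (u : hom (fib_pt x) (fib_pt y)) :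
  par (fib_l x ;; fmap (src M) u) (+) sgn M (fib_pt y) (+) par (fib_r y) =
  par (fib_l x) (+) sgn M (fib_pt x) (+) par (fmap (tgt M) u ;; fib_r y).
Proof.
have := cpt_nat (sgn M) u; rewrite /par !fmapM /=.
move: (fmap _ _) (fmap _ _) (fmap _ _) (fmap _ _) => /=.
move: (sgn M _) (sgn M _) => /=.
by do 6!case.
Qed.

Program Definition fib_natiso (j : J) :
    natiso (functor_comp (to_point (fib_gpd j)) epar)
           (functor_comp (to_point (fib_gpd j)) epar) :=
  @NatIso (fib_gpd j) BO1 _ _ (@fib_sgn j) _.
Next Obligation.
move=> j x y [u /= /andP[/eqP u1 /eqP u2]]; rewrite addbF /fib_sgn -u1.
by rewrite fib_sgn_nat -u2.
Qed.

Definition fib (j : J) : pscalar := @PSpan epoint epoint _ _ _ (fib_natiso j).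

(* The homotopy quotient of the two-sided fibre by the group Aut(j) acting by
   b |-> b ;; g: an arrow x -> y is a pair (u, g) of g in Aut(j) and an arrow
   u : x . g -> y of the fibre.  The sign descends because j has no odd
   automorphism.                                                              *)
Variable j : orient J.
Let j0 : J := incl _ j.

Definition fibq_hom (x y : fib_ob j0) : finType :=
  {u : hom (fib_pt x) (fib_pt y) * hom j0 j0 |
    (fib_l x ;; fmap (src M) u.1 == fib_l y) &&
    (fib_r x ;; u.2 == fmap (tgt M) u.1 ;; fib_r y)}.

Program Definition fibq_gpd : groupoid :=
  @Groupoid (fib_ob j0) fibq_hom
    (fun x => exist _ (idm (fib_pt x), idm j0) _)
    (fun x y z a b =>
       exist _ ((sval a).1 ;; (sval b).1, (sval a).2 ;; (sval b).2) _)
    (fun x y a => exist _ (ginv (sval a).1, ginv (sval a).2) _)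
    _ _ _ _ _ _.
Next Obligation. by move=> x /=; rewrite !fmap1 gcomp1m !gcompm1 !eqxx. Qed.
Next Obligation.
move=> x y z [[a g] /= /andP[/eqP a1 /eqP a2]].
move=> [[b h] /= /andP[/eqP b1 /eqP b2]].
by rewrite !fmapM !gcompA a1 b1 a2 -!gcompA b2 !eqxx.
Qed.
Next Obligation.
move=> x y [[a g] /= /andP[/eqP a1 /eqP a2]].
rewrite -a1 -gcompA -fmapM gcompmV fmap1 gcompm1 eqxx /=.
rewrite -[fib_r y]gcomp1m -(fmap1 (tgt M)) -(gcompVm a) fmapM.
rewrite -[X in X ;; _]gcompA.
by rewrite -a2 -!gcompA gcompmV gcompm1.
Qed.
Next Obligation.
by move=> x y [[a b] e]; apply: val_inj; rewrite /= !gcomp1m.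
Qed.
Next Obligation.
by move=> x y [[a b] e]; apply: val_inj; rewrite /= !gcompm1.
Qed.
Next Obligation. by move=> *; apply: val_inj; rewrite /= !gcompA. Qed.
Next Obligation. by move=> *; apply: val_inj; rewrite /= !gcompmV. Qed.
Next Obligation. by move=> *; apply: val_inj; rewrite /= !gcompVm. Qed.
Next Obligation.
have [A [r rP]] := fin_classes (fib_gpd j0).
exists A, r => x; have [k [[a e]]] := rP x.
by exists k; split; exists (a, idm j0); rewrite /= gcompm1.
Qed.

Program Definition fibq_natiso :
    natiso (functor_comp (to_point fibq_gpd) epar)
           (functor_comp (to_point fibq_gpd) epar) :=
  @NatIso fibq_gpd BO1 _ _ (@fib_sgn j0) _.
Next Obligation.
move=> x y [[u g] /= /andP[/eqP u1 /eqP u2]]; rewrite addbF /fib_sgn -u1.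
rewrite fib_sgn_nat -u2 /par fmapM /=.
have /forallP/(_ g)/negbTE := svalP j; rewrite /par => ->.
by rewrite addbF.
Qed.

Definition fibq : pscalar := @PSpan epoint epoint _ _ _ fibq_natiso.

End TwoSidedFibre.

Record basepoints (I : pgroupoid) := Basepoints {
  bpt :> pi0 (orient I) -> orient I;
  bptK : cancel bpt (@cls (orient I))
}.

Definition pcard (I J : pgroupoid) (bI : basepoints I) (bJ : basepoints J)
    (M : pspan I J) (i : pi0 (orient I)) (j : pi0 (orient J)) : rat :=
  scard (fibq M (incl _ (bI i)) (bJ j)).

(* Main.v *)
(* A finite family of objects r : E -> S meeting every class computes the
   cardinality of S as a sum over E, each object being weighted by the inverse
   of the number of arrows from it to members of the family.  Families for M
   and N induce families for the two-sided fibres and for M x_J N, so that all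
   entries become weighted sums of the signed counts par_sum x y of arrows
   x -> y.  The theorem then reduces to splitting par_sum x y, for x, y in J,
   over the orientable components of J.  If x is orientable, only its own
   component contributes, and each arrow x -> y factors in |Aut(j)| ways through
   the base point j.  If it is not, both sides vanish: precomposing with an odd
   automorphism of x reverses all signs. *)
Require Import Defs.
From mathcomp Require Import all_boot all_order all_algebra.
From mathcomp Require Import boolp ring.
Import Defs.

Set Implicit Arguments.
Unset Strict Implicit.
Unset Printing Implicit Defensive.

Import GRing.Theory Num.Theory.

Local Open Scope gpd_scope.
Local Open Scope ring_scope.

(** * Counting arrows in a groupoid *)

Section Arrows.
Variable S : groupoid.

Lemma gcompK (x y z : S) (a : hom x y) :
  cancel (fun b : hom y z => a ;; b) (fun b => ginv a ;; b).
Proof. by move=> b; rewrite gcompA gcompVm gcomp1m. Qed.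

Lemma gcompKV (x y z : S) (a : hom x y) :
  cancel (fun b : hom x z => ginv a ;; b) (fun b => a ;; b).
Proof. by move=> b; rewrite gcompA gcompmV gcomp1m. Qed.

Lemma card_hom_iso (x x' y y' : S) (a : hom x x') (b : hom y y') :
  #|hom x y| = #|hom x' y'|.
Proof.
apply: (bij_eq_card (f := fun u => ginv a ;; u ;; b)).
exists (fun v => a ;; v ;; ginv b) => [u|v].
  by rewrite -!gcompA gcompmV gcompm1 gcompKV.
by rewrite -!gcompA gcompVm gcompm1 gcompK.
Qed.

Lemma card_hom_gt0 (x y : S) : (0 < #|hom x y|)%N = (cls x == cls y).
Proof. by apply/isomorphicP/eqP; rewrite clsP. Qed.

Lemma card_hom_rep (x y : S) :
  #|hom x y| =
    ((cls x == cls y) * #|hom (rep (cls x)) (rep (cls x))|)%N.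
Proof.
have [xy|xy] := eqVneq; last first.
  by apply/eqP; rewrite mul0n -leqn0 leqNgt card_hom_gt0.
have /clsP[a] : cls x = cls (rep (cls x)) by rewrite repK.
have /clsP[b] : cls y = cls (rep (cls x)) by rewrite repK xy.
by rewrite mul1n; exact: card_hom_iso.
Qed.

End Arrows.

(** * Cardinalities computed from a finite atlas *)

Definition atlas (S : groupoid) (E : finType) (r : E -> S) : Prop :=
  forall x, exists e, inhabited (hom x (r e)).

(** Taken as the size of one finite type rather than as a sum, so that weights can be compared
    through bijections. *)
Definition weight (S : groupoid) (E : finType) (r : E -> S) (e : E) : nat :=
  #|{: {e' : E & hom (r e) (r e')}}|.

Lemma weightE (S : groupoid) (E : finType) (r : E -> S) e :
  weight r e = (\sum_e' #|hom (r e) (r e')|)%N.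
Proof. by rewrite /weight card_tagged sumnE big_map big_enum. Qed.

(* If n base points lie in the class c, each of them has weight n |Aut c|. *)
Lemma gcard_atlas (S : groupoid) (E : finType) (r : E -> S) :
  atlas r -> gcard S = \sum_e (weight r e)%:R^-1.
Proof.
move=> rP; rewrite (partition_big (fun e => cls (r e)) xpredT) //=.
apply: eq_bigr => c _; pose n := #|[pred e | cls (r e) == c]|.
have n_gt0 : (0 < n)%N.
  have [e re] := rP (rep c); apply/card_gt0P; exists e.
  by rewrite inE eq_sym -[X in X == _]repK; apply/eqP/clsP.
have W e : cls (r e) == c -> weight r e = (n * #|hom (rep c) (rep c)|)%N.
  move=> /eqP ec; rewrite weightE.
  under eq_bigr => e' _ do rewrite card_hom_rep ec eq_sym.
  by rewrite -big_distrl /= -big_mkcond sum1_card.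
rewrite (eq_bigr _ (fun e ec => congr1 (fun m => m%:R^-1) (W e ec))).
rewrite sumr_const -/n natrM invfM -mulrnAl -[n%:R^-1 *+ n]mulr_natl.
by rewrite divff ?mul1r // pnatr_eq0 -lt0n.
Qed.

(** Since [P] is invariant under isomorphism, no arrow joins members inside [P] to members outside
    it, so restricting the atlas leaves the weights unchanged. *)
Lemma gcard_full_sub (S : groupoid) (E : finType) (r : E -> S) (P : pred S) :
  (forall x y, hom x y -> P x = P y) -> atlas r ->
  gcard (full_sub P) = \sum_(e | P (r e)) (weight r e)%:R^-1.
Proof.
move=> Piso rP; pose E' : finType := {e : E | P (r e)}.
pose r' (e : E') : full_sub P := exist _ (r (val e)) (valP e).
have r'P : atlas r'.
  move=> [x Px]; have [e [a]] := rP x.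
  have Pe : P (r e) by rewrite -(Piso _ _ a).
  by exists (exist _ e Pe); split; exact: a.
rewrite (gcard_atlas r'P).
rewrite (big_sub [pred e | P (r e)] (fun e => (weight r e)%:R^-1)).
apply: eq_bigr => e _; congr (_%:R^-1); rewrite !weightE.
rewrite (bigID (fun e' => P (r e'))) /= [X in (_ + X)%N]big1 => [|e' Pe'].
  rewrite addn0.
  by rewrite (big_sub [pred e | P (r e)] (fun e' => #|hom (r (val e)) (r e')|)).
apply/eqP; rewrite -leqn0 leqNgt; apply: contra Pe' => /isomorphicP[a].
by rewrite -(Piso _ _ a); exact: (valP e).
Qed.

Lemma scard_atlas (S : pscalar) (E : finType) (r : E -> apex S) :
  atlas r ->
  scard S = \sum_e (-1) ^+ (sgn S (r e) : bool) * (weight r e)%:R^-1.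
Proof.
move=> rP.
have siso (x y : apex S) : hom x y -> is_neg x = is_neg y.
  by move=> a; have := cpt_nat (sgn S) a; rewrite /= /is_neg addbF.
rewrite /scard (gcard_full_sub siso rP).
rewrite (gcard_full_sub (P := fun x => ~~ is_neg x) _ rP) => [|x y /siso -> //].
rewrite [RHS](bigID (fun e => is_neg (r e))) /= addrC; congr (_ + _).
  by apply: eq_bigr => e; rewrite /is_neg => /negbTE->; rewrite mul1r.
by rewrite -sumrN; apply: eq_bigr => e; rewrite /is_neg => ->; rewrite mulN1r.
Qed.

Lemma parM (I : pgroupoid) (x y z : I) (a : hom x y) (b : hom y z) :
  par (a ;; b) = par a (+) par b.
Proof. by rewrite /par fmapM. Qed.

(** Equals the cardinality of the two-sided fibre of the identity span at [x] and [y]. *)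
Definition par_sum (I : pgroupoid) (x y : I) : rat :=
  \sum_(c : hom x y) (-1) ^+ par c.

(** * Entries of the cardinality matrix as weighted sums *)

Section FibreAtlas.
Variables (I J : pgroupoid) (M : pspan I J) (i : I) (j : orient J).
Variables (A : finType) (r : A -> apex M).

Let j0 : J := incl _ j.

Definition fib_index : finType :=
  {al : A & hom i (src M (r al)) * hom (tgt M (r al)) j0}%type.

Definition fib_chart (e : fib_index) : fibq_gpd M i j :=
  FibOb (projT2 e).1 (projT2 e).2.

Lemma fib_chart_atlas : atlas r -> atlas fib_chart.
Proof.
move=> rP [m a b]; have [al [c]] := rP m.
pose e : fib_index :=
  Tagged _ (a ;; fmap (src M) c, fmap (tgt M) (ginv c) ;; b).
exists e; split; exists (c, idm j0) => /=.
by rewrite gcompA -fmapM gcompmV fmap1 gcomp1m gcompm1 !eqxx.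
Qed.

(* An arrow out of a point of the quotient fibre is determined by its
   component in the apex and the element of Aut(j): these transport a and b. *)
Lemma weight_fib_chart (e : fib_index) :
  weight fib_chart e = (weight r (tag e) * #|hom j0 j0|)%N.
Proof.
rewrite /weight -card_prod; case: e => al [a b].
pose T1 := {e' : fib_index & hom (fib_chart (Tagged _ (a, b))) (fib_chart e')}.
pose T2 := ({al' : A & hom (r al) (r al')} * hom j0 j0)%type.
pose f (t : T1) : T2 :=
  (existT _ (tag (tag t)) (sval (tagged t)).1, (sval (tagged t)).2).
have gP (t : T2) : (a ;; fmap (src M) (tagged t.1) ==
      a ;; fmap (src M) (tagged t.1)) &&
    (b ;; t.2 == fmap (tgt M) (tagged t.1) ;;
      (fmap (tgt M) (ginv (tagged t.1)) ;; (b ;; t.2))).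
  by rewrite [X in _ && (_ == X)]gcompA -fmapM gcompmV fmap1 gcomp1m !eqxx.
pose g (t : T2) : T1 := existT
  (fun e' : fib_index => hom (fib_chart (Tagged _ (a, b))) (fib_chart e'))
  (existT _ (tag t.1) (a ;; fmap (src M) (tagged t.1),
    fmap (tgt M) (ginv (tagged t.1)) ;; (b ;; t.2)))
  (exist _ (tagged t.1, t.2) (gP t)).
apply: (bij_eq_card (f := f)); exists g => [|[[al' u] h] //].
move=> [[al' [a' b']] [[]]] /= u h ab; rewrite /g /f /=.
have [/eqP ea /eqP eb] := andP ab.
have eb' : b' = fmap (tgt M) (ginv u) ;; (b ;; h).
  by rewrite eb gcompA -fmapM gcompVm fmap1 gcomp1m.
subst b'; clear eb; subst a'.
by congr (existT _ _ _); exact: val_inj.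
Qed.

(** Weight and sign of [(al, (a, b))] are products in which [a] and [b] occur separately, so summing
    over them yields two independent factors [par_sum]. *)
Lemma scard_fibq : atlas r ->
  scard (fibq M i j) = #|hom j0 j0|%:R^-1 *
    \sum_al (weight r al)%:R^-1 * (-1) ^+ (sgn M (r al) : bool) *
      par_sum i (src M (r al)) * par_sum (tgt M (r al)) j0.
Proof.
move=> rP; rewrite (scard_atlas (S := fibq M i j) (fib_chart_atlas rP)).
rewrite mulr_sumr; under [RHS]eq_bigr => al _.
  rewrite -mulrA /par_sum big_distrlr /= !mulr_sumr.
  under eq_bigr => a _ do rewrite !mulr_sumr.
  rewrite pair_bigA.
  over.
rewrite sig_big_dep /=; apply: eq_bigr => -[al [a b]] _.
rewrite weight_fib_chart natrM invfM /= /fib_sgn /= !signr_addb.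
by ring.
Qed.

End FibreAtlas.

(** * An atlas of the homotopy pullback *)

Section PullbackAtlas.
Variables (S T J : groupoid) (F : functor S J) (G : functor T J).
Variables (A B : finType) (r : A -> S) (s : B -> T).

Definition hpb_index : finType := {u : A * B & hom (F (r u.1)) (G (s u.2))}.

Definition hpb_chart (e : hpb_index) : hpb F G := HpbOb (projT2 e).

Lemma hpb_chart_atlas : atlas r -> atlas s -> atlas hpb_chart.
Proof.
move=> rP sP [m n c]; have [al [a]] := rP m; have [be [b]] := sP n.
exists (existT (fun u : A * B => hom (F (r u.1)) (G (s u.2)) : Type) (al, be)
  (fmap F (ginv a) ;; c ;; fmap G b)); split.
exists (a, b) => /=.
by rewrite !gcompA -fmapM gcompmV fmap1 gcomp1m.
Qed.

(** The components [u] and [v] of an arrow out of [c] can be chosen freely; they force the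
    connecting arrow of its target to be [c']. *)
Lemma weight_hpb_chart (e : hpb_index) :
  weight hpb_chart e = (weight r (tag e).1 * weight s (tag e).2)%N.
Proof.
rewrite /weight -card_prod; case: e => -[al be] c.
pose e : hpb_index := existT _ (al, be) c.
pose T1 := {e' : hpb_index & hom (hpb_chart e) (hpb_chart e')}.
pose T2 :=
  ({al' : A & hom (r al) (r al')} * {be' : B & hom (s be) (s be')})%type.
pose f (t : T1) : T2 := (existT _ (tag (tag t)).1 (sval (tagged t)).1,
  existT _ (tag (tag t)).2 (sval (tagged t)).2).
pose c' (t : T2) := fmap F (ginv (tagged t.1)) ;; (c ;; fmap G (tagged t.2)).
have gP (t : T2) : fmap F (tagged t.1) ;; c' t == c ;; fmap G (tagged t.2).
  by rewrite gcompA -fmapM gcompmV fmap1 gcomp1m.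
pose g (t : T2) : T1 := existT
  (fun e' : hpb_index => hom (hpb_chart e) (hpb_chart e'))
  (existT (fun u : A * B => hom (F (r u.1)) (G (s u.2)) : Type)
    (tag t.1, tag t.2) (c' t))
  (exist _ (tagged t.1, tagged t.2) (gP t)).
apply: (bij_eq_card (f := f)); exists g => [|[[al' u] [be' v]] //].
move=> [[[al' be'] d] [[]]] /= u v uv; rewrite /g /f /=.
have ed : d = fmap F (ginv u) ;; (c ;; fmap G v).
  by rewrite -(eqP uv) gcompA -fmapM gcompVm fmap1 gcomp1m.
subst d; by congr (existT _ _ _); exact: val_inj.
Qed.

End PullbackAtlas.

Arguments hpb_chart {S T J} F G {A B} r s e.

(** * Splitting signed counts over orientable components *)

Section ParitySum.
Variables (J : pgroupoid) (bJ : basepoints J).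

Lemma par_sum_orientable (x y : J) : par_sum x y != 0 -> orientable x.
Proof.
apply: contraR => /forallPn[g]; rewrite negbK => g_odd.
suff : par_sum x y *+ 2 == 0 by rewrite mulrn_eq0.
(* Only one of the two copies is reindexed along the odd [g], so the terms cancel in pairs. *)
rewrite mulr2n {1}/par_sum (reindex_inj (can_inj (gcompK g))) -big_split /=.
by rewrite big1 // => c _; rewrite parM g_odd signr_addb mulN1r addNr.
Qed.

Lemma par_sum_comp (x z y : J) (b : hom x z) :
  par_sum x y = (-1) ^+ par b * par_sum z y.
Proof.
rewrite /par_sum (reindex (fun a => b ;; a)) /=; last first.
  by exists (fun c => ginv b ;; c) => c _; rewrite ?gcompK ?gcompKV.
by rewrite mulr_sumr; apply: eq_bigr => c _; rewrite parM signr_addb.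
Qed.

Lemma par_sum_split (x y : J) :
  par_sum x y =
  \sum_(j : pi0 (orient J)) #|hom (incl _ (bJ j)) (incl _ (bJ j))|%:R^-1 *
    par_sum x (incl _ (bJ j)) * par_sum (incl _ (bJ j)) y.
Proof.
have [xo|xno] := boolP (orientable x); last first.
  have x0 z : par_sum x z = 0.
    by apply/eqP; apply: contraR xno; exact: par_sum_orientable.
  by rewrite x0 big1 // => j _; rewrite x0 mulr0 mul0r.
pose x' : orient J := exist _ x xo; pose j := cls x'.
have [b0] : inhabited (hom x (incl _ (bJ j))).
  by apply/(@clsP (orient J) x'); rewrite bptK.
rewrite (bigD1 j) //= [X in _ + X]big1 => [|j' j'j]; last first.
  rewrite {1}/par_sum [X in _ * X * _]big1 ?mulr0 ?mul0r // => b.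
  case/eqP: j'j; rewrite -[j'](bptK bJ); apply/clsP.
  exact: (inhabits (ginv b : hom (bJ j') x')).
rewrite addr0 -mulrA [par_sum x (incl _ _)]/par_sum mulr_suml.
(* Each arrow [b] from [x] to the base point contributes all of [par_sum x y], and there are as many
   such arrows as automorphisms of the base point. *)
under [X in _ * X]eq_bigr => b _ do rewrite -par_sum_comp.
rewrite sumr_const (card_hom_iso b0 (idm (incl _ (bJ j)))).
rewrite -[par_sum _ _ *+ _]mulr_natl mulKf //.
by rewrite pnatr_eq0 -lt0n card_hom_gt0.
Qed.

End ParitySum.

Theorem proposition3p3p3 (I J K : pgroupoid)
    (bI : basepoints I) (bJ : basepoints J) (bK : basepoints K)
    (M : pspan I J) (N : pspan J K)
    (i : pi0 (orient I)) (k : pi0 (orient K)) :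
  pcard bI bK (pspan_comp M N) i k =
    (\sum_(j : pi0 (orient J)) pcard bI bJ M i j * pcard bJ bK N j k)%R.
Proof.
have [A [r rP]] := fin_classes (apex M).
have [B [s sP]] := fin_classes (apex N).
pose rs := hpb_chart (tgt M) (src N) r s.
have rsP : atlas rs by exact: hpb_chart_atlas.
rewrite /pcard (scard_fibq (M := pspan_comp M N) _ _ rsP).
set i0 := incl _ (bI i); set k0 := incl _ (bK k); set kk := #|_|%:R^-1.
(* Summing over the connecting arrow [c] leaves [par_sum (tgt M (r al)) (src N (s be))] as the only
   factor that couples [al] and [be]. *)
have -> : \sum_e (weight rs e)%:R^-1 *
      (-1) ^+ (sgn (pspan_comp M N) (rs e) : bool) *
      par_sum i0 (src (pspan_comp M N) (rs e)) *
      par_sum (tgt (pspan_comp M N) (rs e)) k0 =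
    \sum_al \sum_be ((weight r al)%:R^-1 * (-1) ^+ (sgn M (r al) : bool) *
      par_sum i0 (src M (r al)) * ((weight s be)%:R^-1 *
      (-1) ^+ (sgn N (s be) : bool) * par_sum (tgt N (s be)) k0)) *
      par_sum (tgt M (r al)) (src N (s be)).
  rewrite pair_bigA; under [RHS]eq_bigr => u _ do
    rewrite [par_sum (tgt M _) _]/par_sum mulr_sumr.
  rewrite sig_big_dep /=; apply: eq_bigr => -[u c] _ /=.
  by rewrite weight_hpb_chart natrM invfM !signr_addb /=; ring.
under [RHS]eq_bigr => j _ do rewrite (scard_fibq _ _ rP) (scard_fibq _ _ sP)
  mulrACA big_distrlr mulr_sumr /=.
rewrite [RHS]exchange_big mulr_sumr; apply: eq_bigr => al _.
under [RHS]eq_bigr => j _ do rewrite mulr_sumr.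
rewrite [RHS]exchange_big mulr_sumr; apply: eq_bigr => be _.
(* The factor inverse to the order of Aut(j) produced by the splitting is the one carried by the
   entry of [M], while [kk] comes from the entry of [N]. *)
rewrite (par_sum_split bJ) [X in kk * X]mulr_sumr mulr_sumr.
by apply: eq_bigr => j _; rewrite /kk /k0 /=; ring.
Qed.
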